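(* Let $w={\bf c}^{n_0}{\bf d}{\bf c}^{n_1}{\bf d}\cdots{\bf d}{\bf c}^{n_k}$ with $k\ge0$ and $n_0,\dots,n_k\ge0$. Then $$\Xi_w=(-1)^{k+\frac{|w|-n_0}{2}}\left(q^{-\frac{n_0+1}{2}}B_{n_0}(-q)-q^{\frac{n_0+1}{2}}B_{n_0}\!\left(\tfrac{-1}{q}\right)\right)\prod_{j=1}^kC_{\frac{n_j}{2}}.$$ In particular, $\Xi_w=0$ unless $n_1\equiv n_2\equiv\cdots\equiv n_k\equiv0\pmod 2$.
   Context: ${\bf c},{\bf d}$ are noncommuting variables of degrees $1$ and $2$; $|w|$ is the degree of a ${\bf cd}$-word $w$. $C_i=\frac{1}{2i+1}\binom{2i+1}{i}$ is the $i$-th Catalan number for $i\in\mathbb N$, and $C_i=0$ if $i\notin\mathbb N$ (so the product above is $0$ when some $n_j$, $j\ge1$, is odd). The ballot polynomial is $B_k(q)=\sum_{i=0}^{\lfloor k/2\rfloor}\frac{k+1-2i}{k+1}\binom{k+1}{i}q^i$. Quasisymmetric functions: $M_\alpha=\sum_{i_1<\cdots<i_k}x_{i_1}^{\alpha_1}\cdots x_{i_k}^{\alpha_k}$ for a composition $\alpha=\alpha_1\cdots\alpha_k$, $L_\beta=\sum_{\alpha\text{ refines }\beta}M_\alpha$, and $L^{(n)}_T=L_\beta$ for the composition $\beta$ of $n$ corresponding to $T\subseteq[n-1]$ via $\beta_1\cdots\beta_r\mapsto\{\beta_1,\beta_1+\beta_2,\dots,\beta_1+\cdots+\beta_{r-1}\}$.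 For a ${\bf cd}$-word written $w={\bf c}^{p_1}{\bf d}{\bf c}^{p_2}{\bf d}\cdots{\bf c}^{p_r}{\bf d}{\bf c}^{p_0}$ of degree $n$, let $m_j=\deg({\bf c}^{p_1}{\bf d}\cdots{\bf c}^{p_j}{\bf d})$ and $\Theta_w=\sum L^{(n+1)}_T$ over $T\subseteq[n]$ such that both $T$ and $[n]\setminus T$ meet every $\{m_j-1,m_j\}$, $j=1,\dots,r$. For $j\in\mathbb Q$, $D_j(\sum_ia_iq^i)=\sum_{i=0}^{\lfloor j\rfloor}a_iq^i$. For a nonempty composition $\alpha=\alpha_1\cdots\alpha_k$ with $|\alpha|=\sum\alpha_i$: $\Psi_\alpha=(q-1)^{|\alpha|}$ if $k=1$, and $\Psi_\alpha=(q-1)^{\alpha_1}D_{(|\alpha^-|-1)/2}(\Psi_{\alpha^-})$ with $\alpha^-=\alpha_2\cdots\alpha_k$ if $k\ge2$. $\mathcal K$ is the linear map into $\mathbb Z[q^{1/2},q^{-1/2}]$ with $\mathcal K(M_\alpha)=(-1)^{k}q^{-|\alpha|/2}\Psi_\alpha$, and $\Xi_w=\mathcal K(\Theta_w)$. *)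

(* Defs.v *)
From HB Require Import structures.
From mathcomp Require Import all_boot all_order all_algebra finmap.
From mathcomp Require Import all_classical.

Set Implicit Arguments.
Unset Strict Implicit.
Unset Printing Implicit Defensive.

Import Order.TTheory GRing.Theory Num.Theory.
Local Open Scope ring_scope.

Definition composition := {s : seq nat | 0%N \notin s}.

Definition csize (a : composition) : nat := size (sval a).
Definition csum (a : composition) : nat := sumn (sval a).

(* [a] refines [b]: [b] is obtained by adding up consecutive blocks of [a]
   (no block is empty, since the parts of [b] are positive). *)
Definition refines (a b : composition) : Prop :=
  exists blocks : seq (seq nat),
    flatten blocks = sval a /\ map sumn blocks = sval b.

Lemma csum_refines a b : refines a b -> csum a = csum b.
Proof. by case=> bl [Ea Eb]; rewrite /csum -Ea -Eb sumn_flatten. Qed.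

Lemma finite_csum_le d : finite_set [set a : composition | (csum a <= d)%N].
Proof.
pose g (t : d.-bseq 'I_d.+1) : composition :=
  insubd (exist _ [::] isT : composition) [seq val i | i <- t].
apply: (@sub_finite_set _ _ (range g)); last exact/finite_image/finite_finset.
case=> s s0 /=; rewrite /csum /= => sd.
have szs : (size s <= d)%N.
  apply: leq_trans sd; elim: s s0 => //= x s IHs.
  rewrite inE negb_or => /andP[x0 /IHs szs].
  by rewrite -add1n leq_add // lt0n eq_sym.
have les : all (fun x => x < d.+1)%N s.
  apply/allP => x xs; rewrite ltnS; apply: leq_trans sd.
  elim: s xs {s0 szs} => //= y s IHs; rewrite inE => /predU1P[->|/IHs xs].
    exact: leq_addr.
  exact: leq_trans xs (leq_addl _ _).
have Es : [seq val i | i <- (pmap insub s : seq 'I_d.+1)] = s.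
  rewrite (pmap_filter (@insubK _ _ _)); apply/all_filterP.
  by apply: sub_all les => x xd; rewrite insubT.
have sz : (size (pmap insub s : seq 'I_d.+1) <= d)%N.
  by rewrite -(size_map val) Es.
exists (Bseq sz) => //; apply: val_inj => /=.
by rewrite val_insubd /= Es s0.
Qed.

Lemma finite_refines b : finite_set [set a | refines a b].
Proof.
by apply: sub_finite_set (finite_csum_le (csum b)) => a /= /csum_refines->.
Qed.

Lemma notin0_pairmap_subn m s :
  path ltn m s -> 0%N \notin pairmap (fun i j => j - i)%N m s.
Proof.
elim: s m => //= x s IHs m /andP[mx /IHs].
by rewrite inE negb_or => ->; rewrite eq_sym subn_eq0 -ltnNge mx.
Qed.

(* Subsets of [n] = {1, ..., n} are represented by [T : {set 'I_n}], the
   ordinal [i] standing for the integer [i.+1]. *)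
Definition elements (n : nat) (T : {set 'I_n}) : seq nat :=
  [seq (val i).+1 | i <- enum T].

Lemma path_elements n (T : {set 'I_n}) :
  path ltn 0%N (rcons (elements T) n.+1).
Proof.
have sT : sorted ltn (map val (enum T)).
  rewrite -[enum _](eq_filter (mem_enum _)).
  rewrite -(eq_filter (mem_map val_inj _)) -filter_map.
  by rewrite (sorted_filter ltn_trans) // unlock val_ord_enum iota_ltn_sorted.
rewrite rcons_path (path_sortedE ltn_trans) /elements.
rewrite (map_comp S val) sorted_map (eq_sorted (e' := ltn)) // sT andbT.
apply/andP; split; first by apply/allP => x /mapP[y _ ->].
case: (lastP (enum T)) => //= t x.
by rewrite !map_rcons last_rcons /= ltnS.
Qed.

(* The composition [b] of [n + 1] whose set of proper partial sums
   {b_1, b_1 + b_2, ..., b_1 + ... + b_(r-1)} is [T]. *)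
Definition comp_of_set (n : nat) (T : {set 'I_n}) : composition :=
  exist _ (pairmap (fun i j => j - i)%N 0%N (rcons (elements T) n.+1))
          (notin0_pairmap_subn (path_elements T)).

Lemma scanl_pairmap_subn m s :
  path ltn m s -> scanl addn m (pairmap (fun i j => j - i)%N m s) = s.
Proof.
by elim: s m => //= x s IHs m /andP[/ltnW mx /IHs]; rewrite subnKC // => ->.
Qed.

Lemma comp_of_setK n (T : {set 'I_n}) :
  scanl addn 0%N (sval (comp_of_set T)) = rcons (elements T) n.+1.
Proof. exact/scanl_pairmap_subn/path_elements. Qed.

Lemma csum_comp_of_set n (T : {set 'I_n}) : csum (comp_of_set T) = n.+1.
Proof.
have last_scanl (s : seq nat) m : last m (scanl addn m s) = (m + sumn s)%N.
  by elim: s m => [|x s IHs] m /=; rewrite ?addn0 // IHs addnA.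
by have := last_scanl (sval (comp_of_set T)) 0%N; rewrite comp_of_setK last_rcons.
Qed.

(* The variables of the power series are x_0, x_1, ... *)

Definition monomial := {fsfun nat -> nat with 0%N}.

(* The nonzero exponents of [m], by increasing index of the variables. *)
Definition exponents (m : monomial) : seq nat :=
  [seq m i | i <- sort leq (finsupp m)].

Definition pseries := monomial -> int.
Identity Coercion fun_of_pseries : pseries >-> Funclass.

Definition quasisymmetric (f : pseries) : Prop :=
  (exists d, forall m, f m <> 0 -> (sumn (exponents m) <= d)%N) /\
  (forall m m', exponents m = exponents m' -> f m = f m').

Definition quasisymmetric_pred : {pred pseries} :=
  fun f => `[< quasisymmetric f >].

Lemma quasisymmetric_closed : zmod_closed quasisymmetric_pred.
Proof.
split=> [|f g /asboolP[[d fd] fE] /asboolP[[e ge] gE]]; apply/asboolP.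
  by split=> //; exists 0%N => m /eqP; rewrite eqxx.
split=> [|m m' mE]; last first.
  by rewrite /GRing.add /GRing.opp /= (fE _ _ mE) (gE _ _ mE).
exists (maxn d e) => m fgm; rewrite leq_max.
have [/eqP fm|/eqP fm] := boolP (f m == 0); last by rewrite fd.
have [/eqP gm|/eqP gm] := boolP (g m == 0); last by rewrite ge // orbT.
by case: fgm; rewrite /GRing.add /GRing.opp /= fm gm subr0.
Qed.

HB.instance Definition _ :=
  GRing.isZmodClosed.Build pseries quasisymmetric_pred quasisymmetric_closed.

Record qsym := QSym {
  qsym_val :> pseries;
  qsym_valP : qsym_val \in quasisymmetric_pred
}.

HB.instance Definition _ := [isSub for qsym_val].
HB.instance Definition _ := [Choice of qsym by <:].
HB.instance Definition _ := [SubChoice_isSubZmodule of qsym by <:].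

(* The monomial [m] occurs in the sum defining M_a, and then exactly once, iff
   its nonzero exponents are a_1, ..., a_k in this order. *)
Definition Mseries (a : composition) : pseries :=
  fun m => (exponents m == sval a)%:R.

Lemma Mseries_quasisymmetric a : Mseries a \in quasisymmetric_pred.
Proof.
apply/asboolP; rewrite /Mseries; split=> [|m m' ->] //.
by exists (csum a) => m; case: eqP => // ->.
Qed.

Definition Mq (a : composition) : qsym := QSym (Mseries_quasisymmetric a).

Definition Lq (b : composition) : qsym :=
  \sum_(a \in [set a | refines a b]) Mq a.

(* L^(n+1)_T for T a subset of [n]. *)
Definition Lset (n : nat) (T : {set 'I_n}) : qsym := Lq (comp_of_set T).

Variant letter := Lc | Ld.

Definition cdword := seq letter.

Definition letter_deg (x : letter) : nat := if x is Lc then 1 else 2.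

Definition cddeg (w : cdword) : nat := sumn (map letter_deg w).

(* c^n0 d c^n1 d ... d c^nk, where ns = [:: n1; ...; nk]. *)
Definition cdword_of (n0 : nat) (ns : seq nat) : cdword :=
  nseq n0 Lc ++ flatten [seq Ld :: nseq n Lc | n <- ns].

(* The numbers m_j: [s] plus the degrees of the prefixes of [w] ending in d. *)
Fixpoint dends (s : nat) (w : cdword) : seq nat :=
  match w with
  | [::] => [::]
  | Lc :: w' => dends s.+1 w'
  | Ld :: w' => s.+2 :: dends s.+2 w'
  end.

Definition meets (n : nat) (T : {set 'I_n}) (m : nat) : bool :=
  has (fun i => i \in [:: m.-1; m]) (elements T).

Definition Theta (w : cdword) : qsym :=
  \sum_(T : {set 'I_(cddeg w)}
        | all (fun m => meets T m && meets (~: T) m) (dends 0 w)) Lset T.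

Definition trunc_poly (j : rat) (p : {poly int}) : {poly int} :=
  \poly_(i < size p) (if i%:Z <= Num.floor j then p`_i else 0).

(* Only nonempty lists matter; the value at [::] is a convention. *)
Fixpoint Psi (a : seq nat) : {poly int} :=
  match a with
  | [::] => 1
  | [:: a1] => ('X - 1) ^+ a1
  | a1 :: a' => ('X - 1) ^+ a1 * trunc_poly (((sumn a')%:R - 1) / 2) (Psi a')
  end.

(* Q(q^(1/2)), a field containing Z[q^(1/2), q^(-1/2)]; the variable 'X is
   q^(1/2). *)
Definition qfield : fieldType := {fraction {poly rat}}.

Definition qhalf : qfield := FracField.tofrac 'X.

Definition qvar : qfield := qhalf ^+ 2.

Definition KM (a : composition) : qfield :=
  (-1) ^+ csize a * qhalf ^- csum a * (map_poly intr (Psi (sval a))).[qvar].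

(* The monomial x_0^(a_1) ... x_(k-1)^(a_k); its coefficient in a
   quasisymmetric function is the coordinate along M_a. *)
Definition comp_monomial (a : composition) : monomial :=
  [fsfun i in seq_fset tt (iota 0 (csize a)) => nth 0%N (sval a) i].

Definition Kmap (f : qsym) : qfield :=
  \sum_(a \in [set: composition]) (f (comp_monomial a))%:~R * KM a.

Lemma exponents_comp_monomial a : exponents (comp_monomial a) = sval a.
Proof.
have supp : finsupp (comp_monomial a) = seq_fset tt (iota 0 (csize a)).
  apply/fsetP => i; rewrite mem_finsupp fsfunE seq_fsetE mem_iota /= add0n.
  case: ltnP => ia; last by rewrite eqxx.
  apply/eqP => a0; have := mem_nth 0%N ia.
  by rewrite a0; apply/negP; exact: (valP a).
rewrite /exponents supp.
have -> : sort leq (seq_fset tt (iota 0 (csize a))) = iota 0 (csize a).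
  apply: (sorted_eq leq_trans anti_leq); rewrite ?iota_sorted //.
    exact/sort_sorted/leq_total.
  rewrite perm_sort; apply: uniq_perm; rewrite ?iota_uniq ?fset_uniq // => i.
  by rewrite seq_fsetE.
apply: (@eq_from_nth _ 0%N); rewrite size_map size_iota // => i ia.
rewrite (nth_map 0%N) ?size_iota // nth_iota // add0n fsfunE.
by rewrite seq_fsetE mem_iota ia.
Qed.

Lemma finite_coordinates (f : qsym) :
  finite_set [set a | f (comp_monomial a) <> 0].
Proof.
have /asboolP[[d fd] _] := qsym_valP f.
apply: sub_finite_set (finite_csum_le d) => a /= /fd.
by rewrite exponents_comp_monomial.
Qed.

Lemma Kmap_is_additive : zmod_morphism Kmap.
Proof.
move=> f g; rewrite /Kmap.
pose A := (fset_set [set a | f (comp_monomial a) <> 0]%classic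
  `|` fset_set [set a | g (comp_monomial a) <> 0]%classic)%fset.
have KE (h : qsym) : (forall a, h (comp_monomial a) <> 0 -> a \in A) ->
    \sum_(a \in [set: composition]) (h (comp_monomial a))%:~R * KM a
    = \sum_(a <- A) (h (comp_monomial a))%:~R * KM a.
  move=> hA; rewrite [LHS]fsbig_supp; apply: fsbig_fwiden => //.
  - move=> a /= [_ ha]; apply: hA => ha0; apply: ha.
    by rewrite /= ha0 mul0r.
  - move=> a /= [Aa nha]; apply: contrapT => /= ha; apply: nha.
    by split.
have fgA a : f (comp_monomial a) <> 0 \/ g (comp_monomial a) <> 0 -> a \in A.
  rewrite in_fsetU !in_fset_set ?inE; try exact: finite_coordinates.
  by case=> h; apply/orP; [left|right]; apply/asboolP.
rewrite !KE.
- rewrite -sumrB; apply: eq_bigr => a _.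
  by rewrite -mulrBl -rmorphB.
- by move=> a ga; apply: fgA; right.
- by move=> a fa; apply: fgA; left.
move=> a fga; apply: fgA; apply: contrapT => /not_orP[/contrapT fa /contrapT ga].
apply: fga; rewrite -[LHS]/(f (comp_monomial a) - g (comp_monomial a)).
by rewrite fa ga subr0.
Qed.

HB.instance Definition _ :=
  GRing.isZmodMorphism.Build qsym qfield Kmap Kmap_is_additive.

Lemma Kmap_Mq a : Kmap (Mq a) = KM a.
Proof.
rewrite /Kmap -(fsbig_widen [set a]%classic) //= => [|b [_ /= ba]].
  by rewrite fsbig_set1 /Mseries exponents_comp_monomial eqxx mul1r.
rewrite /Mseries exponents_comp_monomial; case: eqP => [/val_inj //|_].
by rewrite mul0r.
Qed.

(* The values of K lie in Z[q^(1/2), q^(-1/2)]. *)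
Definition laurent (x : qfield) : Prop :=
  exists (p : {poly int}) (n : nat), x = (map_poly intr p).[qhalf] / qhalf ^+ n.

Lemma qhalf_neq0 : qhalf != 0.
Proof. by rewrite /qhalf tofrac_eq0 polyX_eq0. Qed.

Lemma laurentD x y : laurent x -> laurent y -> laurent (x + y).
Proof.
have qn n : qhalf ^+ n != 0 by rewrite expf_neq0 // qhalf_neq0.
case=> p [m ->] [r [n ->]]; exists (p * 'X^n + r * 'X^m), (m + n)%N.
rewrite rmorphD !rmorphM /= !map_polyXn !hornerE addf_div ?qn //.
by rewrite exprD.
Qed.

Lemma laurent_mulz (c : int) x : laurent x -> laurent (c%:~R * x).
Proof.
case=> p [n ->]; exists (c *: p), n.
by rewrite map_polyZ hornerZ mulrA.
Qed.

Lemma laurent_KM a : laurent (KM a).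
Proof.
exists ((-1) ^+ csize a * (Psi (sval a) \Po 'X^2)), (csum a).
rewrite rmorphM rmorphXn rmorphN rmorph1 /= map_comp_poly map_polyXn.
rewrite hornerM horner_exp hornerN hornerC horner_comp hornerXn.
by rewrite /KM -mulrA [_ ^- _ * _]mulrC mulrA.
Qed.

Lemma laurent_Kmap f : laurent (Kmap f).
Proof.
rewrite /Kmap; apply: big_ind => [||a _]; last exact/laurent_mulz/laurent_KM.
- by exists 0, 0%N; rewrite rmorph0 horner0 mul0r.
- exact: laurentD.
Qed.

Definition Xi (w : cdword) : qfield := Kmap (Theta w).

Definition ballot (k : nat) : {poly rat} :=
  \sum_(i < k./2.+1)
    ((k.+1%:R - 2 * i%:R) / k.+1%:R * 'C(k.+1, i)%:R) *: 'X^i.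

Definition rat_const (a : rat) : qfield := FracField.tofrac a%:P.

HB.instance Definition _ :=
  GRing.RMorphism.copy rat_const (@FracField.tofrac {poly rat} \o polyC).

Definition catalan (x : rat) : rat :=
  if x \is a Num.nat then
    let i := Num.truncn x in 'C(i.*2.+1, i)%:R / i.*2.+1%:R
  else 0.

(* Main.v *)
(* Put x = q^(1/2) and read the recursion for Psi from the last part of the
   composition to the first, one unit at a time: after j units,
   q^(-j/2) Psi is a Laurent polynomial in x, each unit multiplies it by
   x - x^-1, and a break between parts applies the projection N onto the
   negative powers of x. Summing with signs over the refinements, -K(L_T) is
   obtained by applying -N at the elements of T and 1 - N elsewhere, and summing
   over T shows that every letter of w acts by an operator: c acts by
   S = 1 - 2N followed by multiplication by x - x^-1. The vectors met are
   antisymmetric in x <-> x^-1, and on those d extracts the coefficient of x and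
   restarts from x - x^-1. The iterates of c on x - x^-1 have signed ballot
   numbers as coefficients, and those of x are signed Catalan numbers, or 0 when
   the number of iterations is odd. *)
Require Import Defs.
From mathcomp Require Import all_boot all_order all_algebra.
From mathcomp Require Import all_classical.
From mathcomp Require Import zify ring.

Import GRing.Theory.
Local Open Scope ring_scope.

(** * Compositions encoded by bit sequences *)

(* The composition of [size t + 1] attached to the subset of [size t] with
   indicator sequence [t]. *)
Fixpoint bits_comp (t : bitseq) : seq nat :=
  match t with
  | [::] => [:: 1%N]
  | b :: t' => if b then 1%N :: bits_comp t' else incr_nth (bits_comp t') 0
  end.

Lemma bits_comp_cons t : exists x s, bits_comp t = x.+1 :: s.
Proof.
elim: t => [|[] t [x [s E]]] /=; first by exists 0%N, [::].
  by exists 0%N, (bits_comp t).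
by exists x.+1, s; rewrite E.
Qed.

Lemma sumn_bits_comp t : sumn (bits_comp t) = (size t).+1.
Proof.
elim: t => [|[] t] //=; first by rewrite add1n => ->.
by have [x [s ->]] := bits_comp_cons t; rewrite /= !addSn => ->.
Qed.

Lemma bits_comp_neq0 t : 0%N \notin bits_comp t.
Proof.
elim: t => [|[] t] //=; have [x [s ->]] /= := bits_comp_cons t.
by rewrite !inE.
Qed.

Lemma bits_comp_inj : injective bits_comp.
Proof.
elim=> [|b t IHt] [|b' t'] //=.
- by have [x [s ->]] := bits_comp_cons t'; case: b'.
- by have [y [r ->]] := bits_comp_cons t; case: b.
have [x [s E]] := bits_comp_cons t'.
case: b b' => [] [].
- by case=> /IHt->.
- by rewrite E.
- by have [y [r ->]] := bits_comp_cons t.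
have [y [r Ey]] := bits_comp_cons t; rewrite E Ey => -[yx rs].
by rewrite (IHt t') // Ey E yx rs.
Qed.

Definition bits_composition (t : bitseq) : composition :=
  exist _ (bits_comp t) (bits_comp_neq0 t).

Lemma bits_composition_inj : injective bits_composition.
Proof. by move=> s t [/bits_comp_inj]. Qed.

(** The offset [m] is what the induction shifts: the bits of [t] sit at positions [m.+1], [m.+2],
    ... and the last partial sum is [(m + size t).+1]. *)
Lemma pairmap_subn_mask m t :
  pairmap (fun i j => j - i)%N m
    (rcons (mask t (iota m.+1 (size t))) (m + size t).+1) = bits_comp t.
Proof.
elim: t m => [|b t IHt] m /=; first by rewrite addn0 subSnn.
have {}IHt := IHt m.+1; rewrite addSn -addnS in IHt.
case: b => /=; first by rewrite subSnn IHt.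
move: IHt.
have: all (leq m.+2) (rcons (mask t (iota m.+2 (size t))) (m + (size t).+1).+1).
  rewrite all_rcons; apply/andP; split; first by lia.
  by apply/allP => i /mem_mask; rewrite mem_iota => /andP[].
case: (rcons _ _) => [|x r] /=; first by have [? [? ->]] := bits_comp_cons t.
move=> /andP[mx _] <- /=. by rewrite -subSn ?subSS // ltnW.
Qed.

Definition set_bits {n : nat} (T : {set 'I_n}) : bitseq :=
  [seq i \in T | i <- enum 'I_n].

Lemma size_set_bits n (T : {set 'I_n}) : size (set_bits T) = n.
Proof. by rewrite size_map size_enum_ord. Qed.

Lemma set_bitsC n (T : {set 'I_n}) : set_bits (~: T) = map negb (set_bits T).
Proof. by rewrite -map_comp; apply: eq_map => i /=; rewrite inE. Qed.

Lemma elements_mask n (T : {set 'I_n}) :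
  elements T = mask (set_bits T) (iota 1 n).
Proof.
rewrite /elements /set_bits.
have -> : enum T = [seq i <- enum 'I_n | i \in T].
  by rewrite [enum 'I_n]enumT.
rewrite filter_mask map_mask [X in mask _ X](map_comp S val) val_enum_ord.
by rewrite -(iotaDl 1%N).
Qed.

Lemma comp_of_set_bits n (T : {set 'I_n}) :
  comp_of_set T = bits_composition (set_bits T).
Proof.
apply: val_inj => /=; rewrite elements_mask.
by rewrite -(pairmap_subn_mask 0) size_set_bits.
Qed.

(** * Refinement as inclusion of break sets *)

Fixpoint superbits (t : bitseq) : seq bitseq :=
  match t with
  | [::] => [:: [::]]
  | b :: t' => (if b then [::] else map (cons false) (superbits t'))
               ++ map (cons true) (superbits t')
  end.

Lemma uniq_superbits t : uniq (superbits t).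
Proof.
elim: t => //= b t IHt; rewrite cat_uniq map_inj_uniq ?IHt ?andbT; last first.
  by move=> ? ? [].
case: b => /=; first by elim: (map _ _).
rewrite map_inj_uniq ?IHt => [/=|? ? []//].
by apply/hasPn => _ /mapP[s _ ->]; apply/mapP => -[].
Qed.

(** Refining a composition adds breaks to its set of breaks. The induction removes the first unit,
    which either ends the first part of [a] or not. *)
Lemma refines_bits_comp (t : bitseq) (a : seq nat) : 0%N \notin a ->
  (exists bl, flatten bl = a /\ map sumn bl = bits_comp t)
  <-> (exists2 s, s \in superbits t & a = bits_comp s).
Proof.
have sumn0 (s : seq nat) : 0%N \notin s -> sumn s = 0%N -> s = [::].
  by case: s => // -[].
elim: t a => [|b t IHt] a a0 /=.
  split=> [[bl [Ea]]|[s]]; last first.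
    by rewrite inE => /eqP-> ->; exists [:: [:: 1%N]].
  case: bl Ea => [|x [|]] //=; rewrite cats0 => -> [].
  case: a a0 => [|[|[|]] a] //=; rewrite !inE /= => a0 [] /sumn0 -> //.
  by exists [::].
split=> [[bl [Ea Ebl]]|[s]].
  case: b Ebl => /=.
    case: bl Ea => //= x bl Ea [x1 Ebl].
    move: a0; rewrite -Ea mem_cat negb_or => /andP[x0 bl0].
    have Ex : x = [:: 1%N].
      case: x x0 x1 {Ea} => [|[|[|]] x] //=; rewrite !inE /= => x0 [] /sumn0 -> //.
    have /IHt : 0%N \notin flatten bl by [].
    case=> /(_ (ex_intro _ bl (conj erefl Ebl))) [s st Es] _.
    by exists (true :: s); [apply: map_f | rewrite Ex Es].
  have [y [r Et]] := bits_comp_cons t; rewrite Et.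
  case: bl Ea => //= x bl Ea [xy Ebl].
  (* The first block has sum at least 2. If it starts with 1, the refinement adds a break after the
     first unit; if it starts with a larger part, that unit stays merged. *)
  case: x Ea xy => [|[|[|z]] x] //= Ea.
  - by rewrite -Ea in a0.
  - rewrite add1n => -[xy]; move: a0; rewrite -Ea inE /= => a0.
    have [/(_ _)[]] := IHt _ a0.
      by exists (x :: bl); rewrite Et /= xy Ebl.
    move=> s st -> _; exists (true :: s) => //.
    by rewrite mem_cat [X in _ || X]map_f ?orbT.
  case=> xy; move: a0; rewrite -Ea inE /= => a0.
  have z0 : 0%N \notin z.+1 :: x ++ flatten bl by rewrite inE.
  have [/(_ _)[]] := IHt _ z0.
    by exists ((z.+1 :: x) :: bl); rewrite Et /= -xy Ebl.
  move=> s st Es _; exists (false :: s); last by rewrite /= -Es.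
  by rewrite mem_cat map_f.
rewrite mem_cat => /orP[].
  case: b => // /mapP[s' st ->] {s} Ea; rewrite {}Ea in a0 *.
  have [_ []] := IHt _ (bits_comp_neq0 s'); first by exists s'.
  move=> [|[|z x] bl] [Es'] Ebl; have [y [r Et]] := bits_comp_cons t.
  - by rewrite Et in Ebl.
  - by rewrite Et in Ebl.
  by exists ((z.+1 :: x) :: bl) => /=; rewrite -Es' -Ebl.
move=> /mapP[s' st ->] {s} Ea.
have [_ []] := IHt _ (bits_comp_neq0 s'); first by exists s'.
case: b => bl [Es' Ebl].
  by exists ([:: 1%N] :: bl); rewrite /= Ea Es' Ebl.
have [y [r Et]] := bits_comp_cons t.
case: bl Es' Ebl => [|x bl] Es'; rewrite Et => //= -[xy Ebl].
by exists ((1%N :: x) :: bl) => /=; rewrite Ea /= -Es' xy Ebl.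
Qed.

Lemma Kmap_Lset n (T : {set 'I_n}) :
  Kmap (Lset T) = \sum_(s <- superbits (set_bits T)) KM (bits_composition s).
Proof.
have us : uniq (map bits_composition (superbits (set_bits T))).
  by rewrite map_inj_uniq ?uniq_superbits //; apply: bits_composition_inj.
have -> : Lset T = \sum_(a <- map bits_composition (superbits (set_bits T))) Mq a.
  rewrite fsbig_seq // /Lset /Lq; apply: eq_fsbigl => //; apply/predeqP => a /=.
  rewrite comp_of_set_bits /refines /= refines_bits_comp; last first.
    exact: (valP a).
  split=> [[s st Ea]|/mapP[s st ->]]; last by exists s.
  by apply/mapP; exists s => //; apply: val_inj.
by rewrite raddf_sum /= big_map; apply: eq_bigr => s _; rewrite Kmap_Mq.
Qed.

(** * The subsets occurring in Theta_w *)

Fixpoint word_bits (w : cdword) : seq bitseq :=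
  match w with
  | [::] => [:: [::]]
  | Lc :: w' => map (cons false) (word_bits w') ++ map (cons true) (word_bits w')
  | Ld :: w' => map (cat [:: false; true]) (word_bits w')
                ++ map (cat [:: true; false]) (word_bits w')
  end.

Lemma mem_map_cons (T : eqType) (b c : T) t (L : seq (seq T)) :
  (b :: t \in map (cons c) L) = (b == c) && (t \in L).
Proof.
apply/mapP/andP => [[s sL [-> ->]]|[/eqP-> tL]]; first by rewrite eqxx.
by exists t.
Qed.

Lemma nil_map_cons (T : eqType) (c : T) (L : seq (seq T)) :
  ([::] \in map (cons c) L) = false.
Proof. by apply/mapP => -[]. Qed.

Lemma uniq_word_bits w : uniq (word_bits w).
Proof.
have inj (s : bitseq) : injective (cat s) by elim: s => //= ? ? IH ? ? [/IH].
elim: w => [|[] w IHw] //=; rewrite cat_uniq !map_inj_uniq ?IHw ?andbT //.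
all: try by [move=> ? ? [] | exact: (inj [:: _; _])].
  by apply/hasPn => _ /mapP[s _ ->]; rewrite mem_map_cons.
by apply/hasPn => _ /mapP[s _ ->]; apply/mapP => -[].
Qed.

Lemma size_superbits t s : s \in superbits t -> size s = size t.
Proof.
elim: t s => [|b t IHt] s /=; first by rewrite inE => /eqP->.
rewrite mem_cat => /orP[|/mapP[r /IHt <- ->] //].
by case: b => // /mapP[r /IHt <- ->].
Qed.

Lemma size_word_bits w t : t \in word_bits w -> size t = cddeg w.
Proof.
elim: w t => [|[] w IHw] t /=; first by rewrite inE => /eqP->.
all: rewrite mem_cat => /orP[] /mapP[s /IHw sw ->]; by rewrite /= sw.
Qed.

Definition bits_meet (s : nat) (t : bitseq) (m : nat) : bool :=
  has (fun i => i \in [:: m.-1; m]) (mask t (iota s.+1 (size t))).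

Lemma meets_bits n (T : {set 'I_n}) m : Defs.meets T m = bits_meet 0 (set_bits T) m.
Proof. by rewrite /Defs.meets /bits_meet elements_mask size_set_bits. Qed.

Lemma bits_meet_cons s b t m : (s.+2 < m)%N ->
  bits_meet s (b :: t) m = bits_meet s.+1 t m.
Proof.
move=> sm; rewrite /bits_meet /=; case: b => //=; rewrite !inE.
by rewrite ltn_eqF ?ltn_eqF //=; lia.
Qed.

Lemma bits_meet_first s b b' t :
  bits_meet s (b :: b' :: t) s.+2 = b || b'.
Proof.
rewrite /bits_meet; case: b => /=; first by rewrite !inE eqxx.
case: b' => /=; first by rewrite !inE eqxx orbT.
by apply/hasP => -[i /mem_mask]; rewrite mem_iota !inE; lia.
Qed.

Lemma dends_gt s w m : m \in dends s w -> (s.+1 < m)%N.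
Proof.
elim: w s => [|[] w IHw] s //=; first by move=> /IHw; lia.
by rewrite inE => /predU1P[->|/IHw] //; lia.
Qed.

(** A pair of positions meets both a set and its complement iff exactly one of its two bits is true,
    which are the two choices made at a letter d. Later pairs lie beyond the bits already read, so
    the induction only moves [s]. *)
Lemma mem_word_bits s w t :
  (t \in word_bits w) = (size t == cddeg w) &&
    all (fun m => bits_meet s t m && bits_meet s (map negb t) m) (dends s w).
Proof.
elim: w s t => [|[] w IHw] s t /=; first by rewrite inE andbT; case: t.
  rewrite mem_cat; case: t => [|b t]; first by rewrite !nil_map_cons.
  rewrite !mem_map_cons -andb_orl; have -> : (b == false) || (b == true) by case: b.
  rewrite (IHw s.+1) /= eqSS; congr (_ && _); apply: eq_in_all => m /dends_gt sm.
  by rewrite !bits_meet_cons.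
have E (c c' : bool) : map (cat [:: c; c']) (word_bits w)
    = map (cons c) (map (cons c') (word_bits w)) by rewrite -map_comp.
rewrite mem_cat !E; case: t => [|b [|b' t]].
- by rewrite !nil_map_cons.
- by rewrite !mem_map_cons !nil_map_cons !andbF.
rewrite !mem_map_cons (IHw s.+2) /= !bits_meet_first !eqSS.
have -> : all (fun m => bits_meet s (b :: b' :: t) m &&
       bits_meet s (~~ b :: ~~ b' :: map negb t) m) (dends s.+2 w) =
    all (fun m => bits_meet s.+2 t m && bits_meet s.+2 (map negb t) m)
       (dends s.+2 w).
  apply: eq_in_all => m /dends_gt sm.
  by rewrite !bits_meet_cons //; lia.
by case: b b' => [] []; rewrite /= ?andbF ?orbF.
Qed.

Lemma set_bits_inj n : injective (@set_bits n).
Proof.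
move=> S T /eq_in_map ST; apply/setP => i; apply: ST.
by rewrite mem_enum.
Qed.

Lemma bits_set n (t : bitseq) : size t = n -> exists T : {set 'I_n}, set_bits T = t.
Proof.
move=> tn; exists [set i : 'I_n | nth false t i].
rewrite -[RHS](mkseq_nth false) tn /mkseq -val_enum_ord -map_comp.
by apply: eq_map => i /=; rewrite inE.
Qed.

Lemma Kmap_Theta w : Kmap (Theta w) =
  \sum_(t <- word_bits w) \sum_(s <- superbits t) KM (bits_composition s).
Proof.
have PE (T : {set 'I_(cddeg w)}) :
    all (fun m => Defs.meets T m && Defs.meets (~: T) m) (dends 0 w)
    = (set_bits T \in word_bits w).
  rewrite (mem_word_bits 0) size_set_bits eqxx; apply: eq_all => m.
  by rewrite !meets_bits set_bitsC.
rewrite /Theta raddf_sum /= (eq_bigl _ _ PE).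
pose F t := \sum_(s <- superbits t) KM (bits_composition s).
rewrite (eq_bigr (F \o set_bits)) => [|T _]; last exact: Kmap_Lset.
rewrite -big_filter -(big_map set_bits xpredT F).
apply: perm_big; apply: uniq_perm; rewrite ?uniq_word_bits //.
  rewrite map_inj_uniq ?filter_uniq ?index_enum_uniq //; exact: set_bits_inj.
move=> t; apply/mapP/idP => [[T]|tw].
  by rewrite mem_filter => /andP[PT _] ->.
have [T Tt] := bits_set _ _ (size_word_bits _ _ tw).
by exists T => //; rewrite mem_filter Tt tw mem_index_enum.
Qed.

(** * The recursion for Psi, one unit at a time *)

Lemma trunc_polyE m (p : {poly int}) :
  trunc_poly ((m%:R - 1) / 2) p = take_poly (uphalf m) p.
Proof.
apply/polyP => i; rewrite coef_poly coef_take_poly.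
have -> : ((i%:Z : int) <= Num.floor ((m%:R - 1) / 2 : rat)) = (i < uphalf m)%N.
  rewrite Num.Theory.floor_ge_int Num.Theory.ler_pdivlMr //.
  rewrite Num.Theory.lerBrDr -[i%:~R]/(i%:R) -natrM natr1 Num.Theory.ler_nat.
  lia.
by case: ltnP => // ip; case: ifP => //; rewrite nth_default.
Qed.

(* [take_poly (uphalf j)] keeps the monomials 'X^i with [2 * i < j], that is,
   the negative powers of q after normalisation by q^(-j/2). *)
Definition bit_step (b : bool) (j : nat) (f : {poly int}) : {poly int} :=
  ('X - 1) * (if b then - take_poly (uphalf j) f else f - take_poly (uphalf j) f).

Lemma bit_step_sum b j (I : Type) (r : seq I) (F : I -> {poly int}) :
  bit_step b j (\sum_(i <- r) F i) = \sum_(i <- r) bit_step b j (F i).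
Proof.
rewrite /bit_step -mulr_sumr; congr (_ * _).
by case: b; rewrite raddf_sum ?sumrN ?sumrB.
Qed.

(** The sign counts breaks rather than parts, so that each break acts by minus a truncation. *)
Definition signed_Psi (s : bitseq) : {poly int} :=
  (-1) ^+ count id s *: Psi (bits_comp s).

Definition superbits_Psi (t : bitseq) : {poly int} :=
  \sum_(s <- superbits t) signed_Psi s.

Definition word_Psi (w : cdword) : {poly int} :=
  \sum_(t <- word_bits w) superbits_Psi t.

Lemma signed_Psi_true s :
  signed_Psi (true :: s) = bit_step true (size s).+1 (signed_Psi s).
Proof.
have E : Psi (1%N :: bits_comp s)
    = ('X - 1) * take_poly (uphalf (size s).+1) (Psi (bits_comp s)).
  rewrite -sumn_bits_comp -trunc_polyE.
  by have [x [r ->]] := bits_comp_cons s; rewrite -[in RHS](expr1 ('X - 1)).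
rewrite /signed_Psi [bits_comp _]/= E [count _ _]/= exprS /bit_step take_polyZ.
by rewrite -scalerA scaleN1r mulrN -scalerAr.
Qed.

Lemma signed_Psi_false s : signed_Psi (false :: s) = ('X - 1) * signed_Psi s.
Proof.
rewrite /signed_Psi /= -scalerAr; congr (_ *: _).
have [x [[|y r] ->]] := bits_comp_cons s; first by rewrite /= exprS.
by rewrite /= exprS mulrA.
Qed.

(** A true bit forces the break, whose sign gives [- take_poly]. A false bit leaves a choice, and
    adding the merged and the broken case gives [f - take_poly f]. *)
Lemma superbits_Psi_cons b t :
  superbits_Psi (b :: t) = bit_step b (size t).+1 (superbits_Psi t).
Proof.
have E : \sum_(s <- map (cons true) (superbits t)) signed_Psi s
         = bit_step true (size t).+1 (superbits_Psi t).
  rewrite big_map bit_step_sum; apply: eq_big_seq => s st.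
  by rewrite signed_Psi_true (size_superbits _ _ st).
case: b; rewrite /superbits_Psi /= ?big_cat /= E // big_map.
under eq_bigr do rewrite signed_Psi_false.
by rewrite -mulr_sumr -mulrDr.
Qed.

Lemma word_Psi_nil : word_Psi [::] = 'X - 1.
Proof.
by rewrite /word_Psi /superbits_Psi /signed_Psi !big_seq1 /= scale1r expr1.
Qed.

Lemma word_Psi_c w (j := (cddeg w).+1) :
  word_Psi (Lc :: w) = bit_step false j (word_Psi w) + bit_step true j (word_Psi w).
Proof.
rewrite /word_Psi /= big_cat !big_map !bit_step_sum.
by congr (_ + _); apply: eq_big_seq => t tw;
  rewrite superbits_Psi_cons (size_word_bits _ _ tw).
Qed.

Lemma word_Psi_d w (j := (cddeg w).+1) :
  word_Psi (Ld :: w) = bit_step false j.+1 (bit_step true j (word_Psi w))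
                     + bit_step true j.+1 (bit_step false j (word_Psi w)).
Proof.
rewrite /word_Psi /= big_cat !big_map !bit_step_sum.
by congr (_ + _); apply: eq_big_seq => t tw;
  rewrite !superbits_Psi_cons /= (size_word_bits _ _ tw).
Qed.

Lemma size_bits_comp t : size (bits_comp t) = (count id t).+1.
Proof.
elim: t => [|[] t] //=; first by move->.
by have [x [s ->]] := bits_comp_cons t.
Qed.

(** A composition has one part more than it has breaks, hence the overall minus sign. *)
Lemma Xi_word_Psi w :
  Xi w = - (qhalf ^- (cddeg w).+1 * (map_poly intr (word_Psi w)).[qvar]).
Proof.
rewrite /Xi Kmap_Theta /word_Psi rmorph_sum horner_sum mulr_sumr -sumrN.
apply: eq_big_seq => t tw; rewrite /superbits_Psi rmorph_sum horner_sum.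
rewrite mulr_sumr -sumrN; apply: eq_big_seq => s st.
rewrite /KM /csize /csum /= sumn_bits_comp size_bits_comp.
rewrite (size_superbits _ _ st) (size_word_bits _ _ tw) exprS.
rewrite map_polyZ hornerZ rmorphXn rmorphN1 mulN1r !mulNr; congr (- _).
by rewrite mulrA [_ * (-1) ^+ _]mulrC.
Qed.

(** * Signed ballot numbers *)

(* [signed_ballot n e] is the coefficient of [x ^ e], [e > 0], in the [n]-th
   iterate, starting from [x - x^-1], of the map that flips the sign of the
   negative powers of [x] and then multiplies by [x - x^-1]. These iterates are
   antisymmetric in [x <-> x^-1]. *)
Fixpoint signed_ballot (n e : nat) : int :=
  match n, e with
  | _, 0 => 0
  | 0, e'.+1 => (e' == 0%N)%:R
  | n'.+1, e'.+1 => signed_ballot n' e' - signed_ballot n' e'.+2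
  end.

Lemma signed_ballot0 n : signed_ballot n 0 = 0.
Proof. by case: n. Qed.

Lemma signed_ballot_big n e : (n.+1 < e)%N -> signed_ballot n e = 0.
Proof.
elim: n e => [|n IHn] [|e] //=; first by case: e.
by move=> ne; rewrite !IHn ?subr0 //; lia.
Qed.

Definition ballot_num (n i : nat) : int :=
  'C(n, i)%:R - (if i is i'.+1 then 'C(n, i')%:R else 0).

Lemma ballot_numS n i :
  ballot_num n.+1 i = ballot_num n i + (if i is i'.+1 then ballot_num n i' else 0).
Proof.
by case: i => [|[|i]]; rewrite /ballot_num ?bin0 ?binS ?natrD ?bin0 //; ring.
Qed.

(** The symmetry of binomials gives C(n,i) = C(n,i-1) here; this is the boundary value at exponent
    0. *)
Lemma ballot_num_half n i : i.*2 = n.+1 -> ballot_num n i = 0.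
Proof.
case: i => // i [ni]; rewrite /ballot_num -[in 'C(n, i)]bin_sub; last by lia.
by have -> : (n - i = i.+1)%N by [lia]; rewrite subrr.
Qed.

(** Both sides obey the same Pascal-type recursion, and both vanish at [e = 0]. *)
Lemma signed_ballotE n e i : (e + i.*2 = n.+1)%N ->
  signed_ballot n e = (-1) ^+ i * ballot_num n i.
Proof.
elim: n e i => [|n IHn] [|e] i ei.
- by lia.
- by have [-> ->] : e = 0%N /\ i = 0%N by lia.
- by rewrite signed_ballot0 ballot_num_half ?mulr0.
rewrite /= (IHn _ i) ?ballot_numS; last by lia.
case: i ei => [|i] ei; first by rewrite signed_ballot_big ?subr0 ?addr0 //; lia.
by rewrite (IHn _ i) ?exprS; [ring | lia].
Qed.

Lemma signed_ballot_odd n e : odd (e + n.+1) -> signed_ballot n e = 0.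
Proof.
elim: n e => [|n IHn] [|e] //=; first by case: e => //= e; rewrite addn1 //; lia.
by move=> ne; rewrite !IHn ?subrr //; lia.
Qed.

(** The constraint determines [i]. The range of the sum does not depend on [e], so the coefficients
    can later be collected into monomials. *)
Lemma signed_ballot_sum n e : signed_ballot n e =
  \sum_(i < n./2.+1 | e + i.*2 == n.+1) (-1) ^+ i * ballot_num n i.
Proof.
have [oe|/negP ee] := boolP (odd (e + n.+1)).
  by rewrite signed_ballot_odd // big_pred0 // => i; apply/negP; lia.
have [->|e0] := eqVneq e 0%N.
  by rewrite signed_ballot0 big_pred0 // => -[i /=]; lia.
have [ne|en] := ltnP n.+1 e.
  by rewrite signed_ballot_big // big_pred0 // => i; lia.
have ilt : ((n.+1 - e)./2 < n./2.+1)%N by lia.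
rewrite (big_pred1 (Ordinal ilt)) => [|i /=]; last first.
  by rewrite -val_eqE /=; lia.
by apply: signed_ballotE => /=; lia.
Qed.

(** * Action of the letters c and d on coefficients *)

Lemma coef_subX1M (f : {poly int}) i :
  (('X - 1) * f)`_i = (if i is i'.+1 then f`_i' else 0) - f`_i.
Proof. by rewrite mulrBl mul1r coefB coefXM; case: i. Qed.

(** The index i stands for the power x^(2i-j) left after division by q^(j/2), with j = |w|+1, here
    1. Subtraction is truncated and [signed_ballot n 0] is 0, so the first term serves positive
    exponents and the second negative ones. *)
Lemma word_Psi_nil_coef i :
  (word_Psi [::])`_i = signed_ballot 0 (i.*2 - 1) - signed_ballot 0 (1 - i.*2).
Proof.
rewrite word_Psi_nil coefB coefX coef1; case: i => [|[|i]] //.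
Qed.

Lemma word_Psi_c_coef (c : int) n w (j := (cddeg w).+1) : (n < j)%N ->
  (forall i, (word_Psi w)`_i
     = c * (signed_ballot n (i.*2 - j) - signed_ballot n (j - i.*2))) ->
  forall i, (word_Psi (Lc :: w))`_i
     = c * (signed_ballot n.+1 (i.*2 - j.+1) - signed_ballot n.+1 (j.+1 - i.*2)).
Proof.
move=> nj fE i; rewrite word_Psi_c -/j /bit_step -mulrDr coef_subX1M.
set f := word_Psi w in fE *; set u := (X in X`_i).
(* Subtracting the truncation twice flips the sign of the negative powers: the antisymmetric
   difference becomes a symmetric sum. *)
have uE k : u`_k
    = c * (signed_ballot n (k.*2 - j) + signed_ballot n (j - k.*2)).
  rewrite /u coefD coefN coefB coef_take_poly fE; case: ltnP => kj.
    have -> : (k.*2 - j = 0)%N by lia.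
    by rewrite signed_ballot0; ring.
  have -> : (j - k.*2 = 0)%N by lia.
  by rewrite signed_ballot0; ring.
case: i => [|i].
  rewrite uE [in RHS]subn0 [in RHS]sub0n [0.*2]/= sub0n subn0 signed_ballot0 /=.
  (* The recursion also involves the value at [j.+2], which vanishes because [n < j]. *)
  by rewrite (signed_ballot_big n j.+2) ?signed_ballot0; [ring | lia].
(* The exponent of x is negative, positive or zero; in the last case the two neighbouring
   coefficients cancel. *)
rewrite !uE; have [ij|ij|ij] := ltngtP (i.+1).*2 j.+1.
- have -> : (i.+1.*2 - j.+1 = 0)%N by lia.
  have -> : (j.+1 - i.+1.*2 = (j - i.+1.*2).+1)%N by lia.
  have -> : (i.+1.*2 - j = 0)%N by lia.
  have -> : (i.*2 - j = 0)%N by lia.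
  have -> : (j - i.*2 = (j - i.+1.*2).+2)%N by lia.
  by rewrite !signed_ballot0 /=; ring.
- have -> : (j.+1 - i.+1.*2 = 0)%N by lia.
  have -> : (i.+1.*2 - j.+1 = (i.*2 - j).+1)%N by lia.
  have -> : (i.+1.*2 - j = (i.*2 - j).+2)%N by lia.
  have -> : (j - i.*2 = 0)%N by lia.
  have -> : (j - i.+1.*2 = 0)%N by lia.
  by rewrite !signed_ballot0 /=; ring.
have -> : (i.+1.*2 - j.+1 = 0)%N by lia.
have -> : (j.+1 - i.+1.*2 = 0)%N by lia.
have -> : (i.+1.*2 - j = 1)%N by lia.
have -> : (i.*2 - j = 0)%N by lia.
have -> : (j - i.*2 = 1)%N by lia.
have -> : (j - i.+1.*2 = 0)%N by lia.
by rewrite !signed_ballot0; ring.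
Qed.

(** Multiplied by x - x^-1, the negative part reaches a nonnegative exponent only through x^-1,
    which yields a constant; the positive part never reaches a negative exponent. Only this constant
    survives, and it is multiplied by x - x^-1 again. *)
Lemma word_Psi_d_coef (c : int) n w (j := (cddeg w).+1) :
  (forall i, (word_Psi w)`_i
     = c * (signed_ballot n (i.*2 - j) - signed_ballot n (j - i.*2))) ->
  forall i, (word_Psi (Ld :: w))`_i
     = c * signed_ballot n 1
       * (signed_ballot 0 (i.*2 - j.+2) - signed_ballot 0 (j.+2 - i.*2)).
Proof.
move=> fE i; rewrite word_Psi_d -/j /bit_step -mulrDr coef_subX1M.
set f := word_Psi w in fE *; set u := (X in X`_i).
have loE k : (take_poly (uphalf j) f)`_k = - (c * signed_ballot n (j - k.*2)).
  rewrite coef_take_poly fE; case: ltnP => kj.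
    have -> : (k.*2 - j = 0)%N by lia.
    by rewrite signed_ballot0; ring.
  have -> : (j - k.*2 = 0)%N by lia.
  by rewrite signed_ballot0; ring.
have hiE k : (f - take_poly (uphalf j) f)`_k = c * signed_ballot n (k.*2 - j).
  by rewrite coefB loE fE; ring.
have uE k : u`_k = (k.*2 == j.+1)%:R * (c * signed_ballot n 1).
  rewrite /u mulrN coefD !coefN coefB coefN !coef_take_poly !coef_subX1M coefN.
  rewrite loE hiE coef_subX1M loE; case: k => [|k].
    by rewrite sub0n signed_ballot0 /=; ring.
  rewrite loE hiE; case: ltnP => kj.
    have -> : (k.*2 - j = 0)%N by lia.
    have -> : (k.+1.*2 - j = 0)%N by lia.
    have -> : (k.+1.*2 == j.+1) = false by lia.
    by rewrite signed_ballot0 /=; ring.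
  have -> : (j - k.+1.*2 = 0)%N by lia.
  have [kj1|kj1] := eqVneq k.+1.*2 j.+1.
    have -> : (j - k.*2 = 1)%N by lia.
    by rewrite signed_ballot0 /=; ring.
  have -> : (j - k.*2 = 0)%N by lia.
  by rewrite signed_ballot0 /=; ring.
have ballot0 e : signed_ballot 0 e = (e == 1%N)%:R by case: e => [|[]].
rewrite uE !ballot0; case: i => [|i].
  by rewrite sub0n subn0 eqSS /=; ring.
rewrite uE.
have -> : (i.+1.*2 - j.+2 == 1)%N = (i.*2 == j.+1) by lia.
have -> : (j.+2 - i.+1.*2 == 1)%N = (i.+1.*2 == j.+1) by lia.
by ring.
Qed.

(** The rightmost letter acts first: each run of c preceded by a d is reduced to one factor, and
    only the leading run keeps its full iterate. *)
Lemma word_Psi_coef n ns (j := (cddeg (cdword_of n ns)).+1) i :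
  (word_Psi (cdword_of n ns))`_i = (\prod_(m <- ns) signed_ballot m 1)
    * (signed_ballot n (i.*2 - j) - signed_ballot n (j - i.*2)).
Proof.
have cdS m ms : cdword_of m.+1 ms = Lc :: cdword_of m ms by [].
have le_deg m ms : (m <= cddeg (cdword_of m ms))%N.
  by elim: m => // m IHm; rewrite cdS /cddeg /= add1n ltnS.
rewrite {}/j; elim: ns n i => [|m ms IHms] n.
  elim: n => [|n IHn] i; first by rewrite big_nil mul1r; exact: word_Psi_nil_coef.
  by rewrite cdS; apply: word_Psi_c_coef => //; rewrite ltnS.
elim: n => [|n IHn] i; last first.
  by rewrite cdS; apply: word_Psi_c_coef => //; rewrite ltnS.
rewrite big_cons [signed_ballot m 1 * _]mulrC.
exact: (@word_Psi_d_coef _ m (cdword_of m ms)).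
Qed.

Lemma word_Psi_explicit n ns r : (cddeg (cdword_of n ns) = n + r.*2)%N ->
  word_Psi (cdword_of n ns) = (\prod_(m <- ns) signed_ballot m 1) *:
    \sum_(i < n./2.+1)
      ((-1) ^+ i * ballot_num n i) *: ('X^(r + n.+1 - i) - 'X^(r + i)).
Proof.
move=> dE; apply/polyP => k; rewrite word_Psi_coef dE coefZ; congr (_ * _).
rewrite !signed_ballot_sum big_mkcond [X in _ - X]big_mkcond -sumrB coef_sum.
apply: eq_bigr => -[i /= ni] _; rewrite coefZ coefB !coefXn.
have -> : (k.*2 - (n + r.*2).+1 + i.*2 == n.+1)%N = (k == r + n.+1 - i)%N by lia.
have -> : ((n + r.*2).+1 - k.*2 + i.*2 == n.+1)%N = (k == r + i)%N by lia.
by do 2!case: (_ == _); rewrite /=; ring.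
Qed.

(** * Ballot polynomials and Catalan numbers *)

Lemma ballot_coefE n i : (i <= n)%N ->
  (n.+1%:R - 2 * i%:R) / n.+1%:R * 'C(n.+1, i)%:R = (ballot_num n i)%:~R :> rat.
Proof.
move=> ni; have n0 : n.+1%:R != 0 :> rat by rewrite Num.Theory.pnatr_eq0.
have E1 : (n.+1 - i)%:R * 'C(n.+1, i)%:R = n.+1%:R * 'C(n, i)%:R :> rat.
  by rewrite -!natrM -mul_bin_down.
apply: (mulfI n0); rewrite mulrA mulrCA mulfV // mulr1.
rewrite /ballot_num rmorphB /= rmorph_nat mulrBr -E1 natrB 1?leqW //.
case: i ni {E1} => [|i] ni; first by rewrite rmorph0 mulr0; ring.
rewrite rmorph_nat -(natrM _ n.+1 'C(n, i)) (mul_bin_diag n.+1 i) natrM -!natr1; ring.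
Qed.

Lemma map_ballot n : map_poly rat_const (ballot n)
  = \sum_(i < n./2.+1) (ballot_num n i)%:~R *: 'X^i.
Proof.
rewrite /ballot rmorph_sum; apply: eq_bigr => -[i /= ni] _.
rewrite map_polyZ map_polyXn ballot_coefE; last by lia.
by rewrite rmorph_int.
Qed.

Lemma catalan_half_odd m : odd m -> catalan (m%:R / 2) = 0.
Proof.
move=> om; rewrite /catalan; case: Num.Theory.natrP => // -[k] mk; exfalso.
have /eqP : m%:R = (k * 2)%:R :> rat by rewrite natrM -mk mulfVK.
by rewrite Num.Theory.eqr_nat; lia.
Qed.

(** At i = m/2 the numerator m+1-2i of the ballot coefficient is 1, which leaves the Catalan
    number. *)
Lemma catalan_half_even m : ~~ odd m ->
  catalan (m%:R / 2) = (ballot_num m m./2)%:~R.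
Proof.
move=> em; have -> : m%:R / 2 = m./2%:R :> rat.
  by rewrite -[m in LHS]even_halfK // -muln2 natrM mulfK.
rewrite /catalan Num.Theory.natr_nat Num.Theory.natrK even_halfK //.
rewrite -ballot_coefE; last by lia.
have -> : m.+1%:R - 2 * m./2%:R = 1 :> rat.
  by rewrite -natrM mul2n even_halfK // -natr1; ring.
by rewrite mul1r mulrC.
Qed.

Lemma signed_ballot1 m :
  (signed_ballot m 1)%:~R = (-1) ^+ m./2 * catalan (m%:R / 2).
Proof.
have [om|em] := boolP (odd m).
  by rewrite catalan_half_odd // mulr0 signed_ballot_odd // add1n /= negbK.
rewrite catalan_half_even // (signed_ballotE _ _ m./2) ?even_halfK //.
by rewrite rmorphM rmorphXn rmorphN1.
Qed.

(** * Degrees, signs and the final comparison *)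

Lemma cddeg_cdword_of n ns :
  cddeg (cdword_of n ns) = (n + (sumn ns + (size ns).*2))%N.
Proof.
rewrite /cddeg /cdword_of map_cat sumn_cat map_nseq sumn_nseq mul1n.
congr addn; elim: ns => //= m ms IHms.
by rewrite map_cat sumn_cat map_nseq sumn_nseq mul1n IHms; lia.
Qed.

Lemma prod_signed_ballot1 ns : all (fun m => ~~ odd m) ns ->
  (\prod_(m <- ns) signed_ballot m 1)%:~R
  = (-1) ^+ (sumn ns)./2 * \prod_(m <- ns) catalan (m%:R / 2) :> rat.
Proof.
elim: ns => [|m ms IHms]; first by rewrite !big_nil.
case/andP=> em ems; rewrite !big_cons rmorphM /= IHms // signed_ballot1.
by rewrite halfD (negPf em) /= add0n exprD; ring.
Qed.

Lemma prod_catalan0 ns : ~~ all (fun m => ~~ odd m) ns ->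
  \prod_(m <- ns) catalan (m%:R / 2) = 0.
Proof.
rewrite -has_predC => /hasP[m mns /negbNE om].
by rewrite (big_rem m) //= catalan_half_odd // mul0r.
Qed.

Lemma ballot_term (F : fieldType) (x : F) (c : int) n r i :
  x != 0 -> (i <= n)%N ->
  - (x ^- (n + r.*2).+1 * ((-1) ^+ i * c)%:~R
     * ((x ^+ 2) ^+ (r + n.+1 - i) - (x ^+ 2) ^+ (r + i)))
  = x ^- n.+1 * c%:~R * (- x ^+ 2) ^+ i - x ^+ n.+1 * c%:~R * (- 1 / x ^+ 2) ^+ i.
Proof.
move=> x0 ni; have xn0 k : x ^+ k != 0 by rewrite expf_neq0.
have E1 : x ^- (n + r.*2).+1 * (x ^+ 2) ^+ (r + n.+1 - i)
    = x ^+ n.+1 * (x ^+ 2) ^- i.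
  rewrite mulrC -!exprM; apply/eqP; rewrite eqr_div // -!exprD; apply/eqP.
  by congr (_ ^+ _); lia.
have E2 : x ^- (n + r.*2).+1 * (x ^+ 2) ^+ (r + i) = x ^- n.+1 * (x ^+ 2) ^+ i.
  rewrite !(mulrC (_ ^-1)) -!exprM; apply/eqP; rewrite eqr_div // -!exprD.
  by apply/eqP; congr (_ ^+ _); lia.
rewrite intrM intr_sign mulrAC mulrBr E1 E2 mulN1r -exprVn.
rewrite (exprNn (x ^+ 2)) (exprNn (x ^+ 2)^-1).
ring.
Qed.

(* When |w| - n0 is odd, some n_j is odd, so that the product is zero and the
   rounding of (|w| - n0) / 2 is immaterial. *)
Theorem theorem3p3 (n0 : nat) (ns : seq nat) :
  let w := cdword_of n0 ns in
  let k := size ns in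
  let B := map_poly rat_const (ballot n0) in
  Xi w = (-1) ^+ (k + (cddeg w - n0)./2)
         * (qhalf ^- n0.+1 * B.[- qvar] - qhalf ^+ n0.+1 * B.[- 1 / qvar])
         * rat_const (\prod_(n <- ns) catalan (n%:R / 2))
  /\ (~ all (fun n => ~~ odd n) ns -> Xi w = 0).
Proof.
move=> w k B.
have Xi0 : ~~ all (fun n => ~~ odd n) ns -> Xi w = 0.
  move=> ons; rewrite Xi_word_Psi.
  have -> : word_Psi w = 0; last by rewrite rmorph0 horner0 mulr0 oppr0.
  apply/polyP => i; rewrite word_Psi_coef coef0.
  have [m mns om] : exists2 m, m \in ns & odd m.
    by move: ons; rewrite -has_predC => /hasP[m mns /negbNE om]; exists m.
  rewrite (big_rem m) //= [signed_ballot m 1]signed_ballot_odd ?mul0r //.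
  by rewrite add1n /= negbK.
split; last by move=> /negP.
have [ens|ons] := boolP (all (fun n => ~~ odd n) ns); last first.
  by rewrite Xi0 // prod_catalan0 // rmorph0 mulr0.
have esum : ~~ odd (sumn ns).
  by elim: (ns) ens => //= m ms IHms /andP[em /IHms]; rewrite oddD (negPf em).
set r := ((sumn ns)./2 + k)%N.
have degw : cddeg w = (n0 + r.*2)%N.
  by rewrite cddeg_cdword_of doubleD even_halfK.
rewrite Xi_word_Psi (word_Psi_explicit _ _ _ degw) degw addKn doubleK.
(* The letters d contribute 2k to the exponent; what remains is the sign of the product of signed
   Catalan numbers. *)
have -> : (-1 : qfield) ^+ (k + r) = (-1) ^+ (sumn ns)./2.
  by rewrite /r addnCA exprD addnn -mul2n exprM sqrrN !expr1n mulr1.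
rewrite map_polyZ hornerZ /=.
have -> : (\prod_(m <- ns) signed_ballot m 1)%:~R
    = (-1) ^+ (sumn ns)./2 * rat_const (\prod_(m <- ns) catalan (m%:R / 2)).
  rewrite -(rmorph_int rat_const) prod_signed_ballot1 //.
  by rewrite rmorphM rmorphXn rmorphN1.
rewrite mulrCA -mulrN mulrAC; congr (_ * _ * _).
rewrite rmorph_sum horner_sum mulr_sumr /B map_ballot !horner_sum !mulr_sumr.
rewrite -sumrB -sumrN; apply: eq_bigr => -[i /= ni] _.
rewrite map_polyZ rmorphB /= !map_polyXn !hornerE /=.
by apply: ballot_term; [exact: qhalf_neq0 | lia].
Qed.
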